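(* Let $p$ be a prime, $n\ge1$, $R$ an $\mathbb{F}_p$-algebra and $\lambda\in R$. For $2\le s\le p^n-1$ put $E_s=Z_1^s+\sum_{k=2}^{s-1}\binom{s}{k}\lambda^kZ_1^{s-k}Z_{T^k}+\lambda^sZ_{T^s}$ in the polynomial ring $R[Z_1,Z_T,Z_{T^2},\dots,Z_{T^{p^n-1}}]$. Then the $R$-algebra $$R\Big[Z_1^{\pm1},Z_T,Z_{T^2},\dots,Z_{T^{p^n-1}},\frac{1}{Z_1^{p^n}+\lambda^{p^n}Z_T},\frac{1}{E_2},\dots,\frac{1}{E_{p^n-1}}\Big]$$ is isomorphic, as an $R$-algebra, to the algebra of coinvariants $S(A^{(\lambda)}_R)_\Theta^{\mathrm{co}A^{(\lambda)}_R}$ (the coordinate ring of $U(\varGamma^{(\lambda)}_R)/\varGamma^{(\lambda)}_R$).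
   Context: $A^{(\lambda)}_R=R[T]/(T^{p^n})$ is the Hopf algebra with comultiplication $T\mapsto T\otimes1+1\otimes T+\lambda T\otimes T$ and counit $T\mapsto0$, representing the group scheme $\varGamma^{(\lambda)}_R$. The unit group scheme $U(\varGamma^{(\lambda)}_R)$ of the group algebra (the functor $A\mapsto \mathrm{Hom}_R(A^{(\lambda)}_R,A)^\times$ with convolution product) is represented by $S(A^{(\lambda)}_R)_\Theta=R[X_1,X_T,\dots,X_{T^{p^n-1}},1/\Delta]$, where $X_{T^s}(f)=f(T^s)$, $X_1=X_{T^0}$, $\Delta=\prod_{l=0}^{p^n-1}\big(\sum_{k=0}^l\binom{l}{k}\lambda^kX_{T^k}\big)$. The canonical embedding $\varGamma^{(\lambda)}_R\to U(\varGamma^{(\lambda)}_R)$ makes $S(A^{(\lambda)}_R)_\Theta$ a right $A^{(\lambda)}_R$-comodule algebra via the $R$-algebra map $\rho$ with $\rho(X_{T^s})=\sum_{l=0}^s\binom{s}{l}\big(\sum_{k=0}^l\binom{l}{k}\lambda^kX_{T^{k+s-l}}\big)\otimes T^l$; the coinvariants are $S(A^{(\lambda)}_R)_\Theta^{\mathrm{co}A^{(\lambda)}_R}=\{b:\rho(b)=b\otimes1\}$. *)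

(* Defs.v *)
From HB Require Import structures.
From mathcomp Require Import all_boot all_algebra.
From mathcomp Require Import boolp ring.
From mathcomp Require Import mpoly.

Set Implicit Arguments.
Unset Strict Implicit.
Unset Printing Implicit Defensive.

Import GRing.Theory.
Local Open Scope ring_scope.

(* Used to invert rho(Delta): with D_l the l-th factor of Delta, this gives
   rho(D_l) = D_l ⊗ (1 + lam T)^l. *)
Section Umbral.
Context (B : comNzRingType) (Y : nat -> B).

Let L (P : {poly B}) := \sum_(i < size P) P`_i * Y i.

Let L_widen n (P : {poly B}) : (size P <= n)%N -> L P = \sum_(i < n) P`_i * Y i.
Proof.
move=> sP; rewrite /L (big_ord_widen n (fun i => P`_i * Y i)) // big_mkcond.
apply: eq_bigr => i _; case: ltnP => // /(nth_default 0)->.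
by rewrite mul0r.
Qed.

Let L_lin c (P Q : {poly B}) : L (c *: P + Q) = c * L P + L Q.
Proof.
pose n := maxn (size (c *: P + Q)) (maxn (size P) (size Q)).
rewrite !(@L_widen n) ?leq_max ?leqnn ?orbT // mulr_sumr -big_split /=.
by apply: eq_bigr => i _; rewrite coefD coefZ mulrDl mulrA.
Qed.

Let L0 : L 0 = 0. Proof. by rewrite /L size_poly0 big_ord0. Qed.
Let LD : {morph L : P Q / P + Q}.
Proof. by move=> P Q; rewrite -[P in LHS]scale1r L_lin mul1r. Qed.
Let LZ c P : L (c *: P) = c * L P.
Proof. by rewrite -[c *: P]addr0 L_lin L0 addr0. Qed.
Let LX m : L 'X^m = Y m.
Proof.
rewrite /L size_polyXn big_ord_recr /= big1 => [|i _].
  by rewrite coefXn eqxx mul1r add0r.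
by rewrite coefXn (ltn_eqF (ltn_ord i)) mul0r.
Qed.
Let LMn P k : L (P *+ k) = L P *+ k.
Proof. by rewrite -[P *+ k]scaler_nat LZ mulr_natl. Qed.

Lemma umbral (c t : B) l :
  \sum_(s < l.+1) (c ^+ s * (\sum_(j < s.+1)
      (\sum_(k < j.+1) (c ^+ k * Y (k + (s - j))) *+ 'C(j, k)) * t ^+ j
        *+ 'C(s, j))) *+ 'C(l, s) =
  (1 + c * t) ^+ l * \sum_(k < l.+1) (c ^+ k * Y k) *+ 'C(l, k).
Proof.
pose u : {poly B} := 1 + c *: 'X.
have uX j : u ^+ j = \sum_(k < j.+1) (c ^+ k *: 'X^k) *+ 'C(j, k).
  rewrite /u exprDn; apply: eq_bigr => k _.
  by rewrite expr1n mul1r exprZn.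
have uXL j m : L ('X^m * u ^+ j) =
    \sum_(k < j.+1) (c ^+ k * Y (k + m)) *+ 'C(j, k).
  rewrite uX mulr_sumr (big_morph L LD L0); apply: eq_bigr => k _.
  by rewrite mulrnAr LMn -scalerAr LZ -exprD LX addnC.
pose v : {poly B} := 'X + t *: u.
have vXL s : L (v ^+ s) = \sum_(j < s.+1)
      (\sum_(k < j.+1) (c ^+ k * Y (k + (s - j))) *+ 'C(j, k)) * t ^+ j
        *+ 'C(s, j).
  rewrite /v exprDn (big_morph L LD L0); apply: eq_bigr => j _.
  by rewrite LMn exprZn -scalerAr LZ uXL mulrC.
transitivity (L ((1 + c *: v) ^+ l)).
  rewrite exprDn (big_morph L LD L0); apply: eq_bigr => s _.
  by rewrite LMn expr1n mul1r exprZn LZ vXL.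
have -> : 1 + c *: v = (1 + c * t) *: u.
  by rewrite /v scalerDr scalerA addrA -/u scalerDl scale1r.
rewrite exprZn LZ -[u ^+ l]mul1r -(expr0 'X) uXL.
by congr (_ * _); apply: eq_bigr => k _; rewrite addn0.
Qed.

End Umbral.

(* The localization P[1/d], as the quotient of the pairs (a, k), standing for
   a / d^k, by the usual equivalence relation.  MathComp's nzRingType's and
   algebras are nonzero, hence the requirement that d is not nilpotent. *)

Definition nonnilp (P : nzRingType) (d : P) : Prop := forall k, d ^+ k != 0.

Section AwayEquiv.
Context (P : comNzRingType) (d : P).

Definition away_rel (x y : P * nat) : bool :=
  `[< exists j, d ^+ j * (x.1 * d ^+ y.2) = d ^+ j * (y.1 * d ^+ x.2) >].

Lemma away_rel_refl : reflexive away_rel.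
Proof. by move=> x; apply/asboolP; exists 0%N. Qed.

Lemma away_rel_sym : ssrbool.symmetric away_rel.
Proof. by move=> x y; apply/asboolP/asboolP => -[j e]; exists j. Qed.

Lemma away_rel_trans : transitive away_rel.
Proof.
move=> [b m] [a k] [c l] /asboolP[i /= ei] /asboolP[j /= ej]; apply/asboolP.
exists (i + j + m)%N => /=.
have -> : d ^+ (i + j + m) * (a * d ^+ l) =
  d ^+ j * d ^+ l * (d ^+ i * (a * d ^+ m)) by rewrite !exprD; ring.
rewrite ei.
have -> : d ^+ j * d ^+ l * (d ^+ i * (b * d ^+ k)) =
  d ^+ i * d ^+ k * (d ^+ j * (b * d ^+ l)) by ring.
by rewrite ej !exprD; ring.
Qed.

Canonical away_equiv :=
  EquivRel away_rel away_rel_refl away_rel_sym away_rel_trans.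

Definition away (_ : nonnilp d) := {eq_quot away_rel}%qT.

End AwayEquiv.

Section AwayRing.
Context (P : comNzRingType) (d : P) (hd : nonnilp d).

HB.instance Definition _ := Choice.on (away hd).

Definition away_frac (a : P) (k : nat) : away hd :=
  (\pi_({eq_quot away_rel d}) (a, k))%qT.

Local Notation "a // k" := (away_frac a k) (at level 40).

Lemma away_fracP a k b m :
  a // k = b // m <->
  exists j, d ^+ j * (a * d ^+ m) = d ^+ j * (b * d ^+ k).
Proof.
split; first by move/eqmodP/asboolP.
by move=> h; apply/eqmodP/asboolP.
Qed.

Lemma away_frac_eq a k b m : a * d ^+ m = b * d ^+ k -> a // k = b // m.
Proof. by move=> e; apply/away_fracP; exists 0%N; rewrite e. Qed.

Definition away_repr (x : away hd) : P * nat :=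
  (repr (x : {eq_quot away_rel d}))%qT.

Lemma away_reprK x : (away_repr x).1 // (away_repr x).2 = x.
Proof.
by rewrite /away_frac -surjective_pairing; exact: (@reprK _ {eq_quot away_rel d}%qT).
Qed.

Lemma away_ind (K : away hd -> Prop) :
  (forall a k, K (a // k)) -> forall x, K x.
Proof. by move=> h x; rewrite -(away_reprK x). Qed.

Lemma away_repr_frac a k :
  exists j, d ^+ j * ((away_repr (a // k)).1 * d ^+ k) =
            d ^+ j * (a * d ^+ (away_repr (a // k)).2).
Proof. by apply/away_fracP; rewrite away_reprK. Qed.

Definition away_add (x y : away hd) : away hd :=
  let: (a, k) := away_repr x in let: (b, m) := away_repr y in
  (a * d ^+ m + b * d ^+ k) // (k + m).
Definition away_opp (x : away hd) : away hd :=
  let: (a, k) := away_repr x in (- a) // k.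
Definition away_mul (x y : away hd) : away hd :=
  let: (a, k) := away_repr x in let: (b, m) := away_repr y in
  (a * b) // (k + m).

Lemma away_addE a k b m :
  away_add (a // k) (b // m) = (a * d ^+ m + b * d ^+ k) // (k + m).
Proof.
rewrite /away_add; have [i] := away_repr_frac a k.
have [j] := away_repr_frac b m.
case: (away_repr (a // k)) => a' k'; case: (away_repr (b // m)) => b' m' /=.
move=> eb ea; apply/away_fracP; exists (i + j)%N; rewrite !exprD.
transitivity (d ^+ j * d ^+ m * d ^+ m' * (d ^+ i * (a' * d ^+ k)) +
              d ^+ i * d ^+ k * d ^+ k' * (d ^+ j * (b' * d ^+ m))); first by ring.
by rewrite ea eb; ring.
Qed.

Lemma away_oppE a k : away_opp (a // k) = (- a) // k.
Proof.
rewrite /away_opp; have [i] := away_repr_frac a k.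
case: (away_repr (a // k)) => a' k' /= ea; apply/away_fracP; exists i.
by rewrite !mulNr !mulrN ea.
Qed.

Lemma away_mulE a k b m : away_mul (a // k) (b // m) = (a * b) // (k + m).
Proof.
rewrite /away_mul; have [i] := away_repr_frac a k.
have [j] := away_repr_frac b m.
case: (away_repr (a // k)) => a' k'; case: (away_repr (b // m)) => b' m' /=.
move=> eb ea; apply/away_fracP; exists (i + j)%N; rewrite !exprD.
transitivity ((d ^+ i * (a' * d ^+ k)) * (d ^+ j * (b' * d ^+ m))); first by ring.
by rewrite ea eb; ring.
Qed.

Lemma away_addA : associative away_add.
Proof.
elim/away_ind=> a k; elim/away_ind=> b m; elim/away_ind=> c l.
by rewrite !away_addE; apply: away_frac_eq; rewrite !exprD; ring.
Qed.

Lemma away_addC : commutative away_add.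
Proof.
elim/away_ind=> a k; elim/away_ind=> b m.
by rewrite !away_addE; apply: away_frac_eq; rewrite !exprD; ring.
Qed.

Lemma away_add0 : left_id (0 // 0) away_add.
Proof.
elim/away_ind=> a k.
by rewrite !away_addE; apply: away_frac_eq; rewrite !exprD; ring.
Qed.

Lemma away_addN : left_inverse (0 // 0) away_opp away_add.
Proof.
elim/away_ind=> a k.
by rewrite away_oppE !away_addE; apply: away_frac_eq; rewrite !exprD; ring.
Qed.

HB.instance Definition _ :=
  GRing.isZmodule.Build (away hd) away_addA away_addC away_add0 away_addN.

Lemma away_mulA : associative away_mul.
Proof.
elim/away_ind=> a k; elim/away_ind=> b m; elim/away_ind=> c l.
by rewrite !away_mulE; apply: away_frac_eq; rewrite !exprD; ring.
Qed.

Lemma away_mulC : commutative away_mul.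
Proof.
elim/away_ind=> a k; elim/away_ind=> b m.
by rewrite !away_mulE; apply: away_frac_eq; rewrite !exprD; ring.
Qed.

Lemma away_mul1 : left_id (1 // 0) away_mul.
Proof.
elim/away_ind=> a k.
by rewrite !away_mulE; apply: away_frac_eq; rewrite !exprD; ring.
Qed.

Lemma away_mulDl : left_distributive away_mul away_add.
Proof.
elim/away_ind=> a k; elim/away_ind=> b m; elim/away_ind=> c l.
by rewrite !(away_addE, away_mulE); apply: away_frac_eq; rewrite !exprD; ring.
Qed.

Lemma away_1neq0 : 1 // 0 != 0 // 0.
Proof.
apply/eqP => /away_fracP[j]; rewrite expr0 !mulr1 mulr0 => e.
by move: (hd j); rewrite e eqxx.
Qed.

HB.instance Definition _ := GRing.Zmodule_isComNzRing.Build (away hd)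
  away_mulA away_mulC away_mul1 away_mulDl away_1neq0.

Lemma away_fracD a k b m :
  a // k + b // m = (a * d ^+ m + b * d ^+ k) // (k + m).
Proof. exact: away_addE. Qed.

Lemma away_fracN a k : - (a // k) = (- a) // k.
Proof. exact: away_oppE. Qed.

Lemma away_fracM a k b m : (a // k) * (b // m) = (a * b) // (k + m).
Proof. exact: away_mulE. Qed.

Definition away_of (a : P) : away hd := a // 0.

Lemma away_of_zmod : zmod_morphism away_of.
Proof.
by move=> a b; rewrite /away_of away_fracN away_fracD expr0 !mulr1.
Qed.

Lemma away_of_monoid : monoid_morphism away_of.
Proof. by split=> // a b; rewrite /away_of away_fracM. Qed.

HB.instance Definition _ :=
  GRing.isZmodMorphism.Build P (away hd) away_of away_of_zmod.
HB.instance Definition _ :=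
  GRing.isMonoidMorphism.Build P (away hd) away_of away_of_monoid.

Lemma away_of_inv : away_of d * (1 // 1) = 1.
Proof. by rewrite /away_of away_fracM; apply: away_frac_eq; ring. Qed.

Lemma away_fracE a k : a // k = away_of a * (1 // 1) ^+ k.
Proof.
have -> : (1 // 1) ^+ k = 1 // k.
  elim: k => [//|k IH]; rewrite exprS IH away_fracM mulr1 //.
by rewrite /away_of away_fracM mulr1.
Qed.

End AwayRing.

Section AwayAlg.
Context (R : comNzRingType) (P : comAlgType R) (d : P) (hd : nonnilp d).

Definition away_scale (c : R) (x : away hd) : away hd := away_of hd c%:A * x.

Lemma away_scaleA a b x : away_scale a (away_scale b x) = away_scale (a * b) x.
Proof. by rewrite /away_scale mulrA -rmorphM /= -scalerAl mul1r scalerA. Qed.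

Lemma away_scale1 : left_id 1 away_scale.
Proof. by move=> x; rewrite /away_scale scale1r rmorph1 mul1r. Qed.

Lemma away_scaleDr : right_distributive away_scale +%R.
Proof. by move=> c x y; rewrite /away_scale mulrDr. Qed.

Lemma away_scaleDl x : {morph away_scale^~ x : a b / a + b}.
Proof. by move=> a b; rewrite /away_scale scalerDl rmorphD mulrDl. Qed.

HB.instance Definition _ := GRing.Zmodule_isLmodule.Build R (away hd)
  away_scaleA away_scale1 away_scaleDr away_scaleDl.

Lemma away_scaleAl (c : R) (x y : away hd) : c *: (x * y) = c *: x * y.
Proof. exact: mulrA. Qed.

HB.instance Definition _ := GRing.Lmodule_isLalgebra.Build R (away hd)
  away_scaleAl.
HB.instance Definition _ := GRing.Lalgebra_isComAlgebra.Build R (away hd).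

Lemma away_of_scalable : scalable (away_of hd).
Proof.
by move=> c a; rewrite -[c *: a in LHS]mulr_algl rmorphM.
Qed.

HB.instance Definition _ :=
  GRing.isScalable.Build R P (away hd) *:%R (away_of hd) away_of_scalable.

End AwayAlg.

Section AwayLift.
Context (P T : comNzRingType) (d : P) (hd : nonnilp d).
Context (f : {rmorphism P -> T}) (u : T) (fu : f d * u = 1).

Definition away_lift & f d * u = 1 := fun x : away hd =>
  f (away_repr x).1 * u ^+ (away_repr x).2.

Lemma away_lift_frac a k : away_lift fu (away_frac hd a k) = f a * u ^+ k.
Proof.
rewrite /away_lift; have [j] := away_repr_frac hd a k.
case: (away_repr _) => b m /= /(congr1 f); rewrite !rmorphM !rmorphXn /= => e.
have fuX i : f d ^+ i * u ^+ i = 1 by rewrite -exprMn fu expr1n.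
transitivity (u ^+ j * u ^+ k * u ^+ m * (f d ^+ j * (f b * f d ^+ k))).
  transitivity ((f d ^+ j * u ^+ j) * (f d ^+ k * u ^+ k) * (f b * u ^+ m)).
    by rewrite !fuX !mul1r.
  by ring.
rewrite e.
transitivity ((f d ^+ j * u ^+ j) * (f d ^+ m * u ^+ m) * (f a * u ^+ k)).
  by ring.
by rewrite !fuX !mul1r.
Qed.

Lemma away_lift_of a : away_lift fu (away_of hd a) = f a.
Proof. by rewrite away_lift_frac mulr1. Qed.

Lemma away_lift_zmod : zmod_morphism (away_lift fu).
Proof.
elim/away_ind=> a k; elim/away_ind=> b m.
rewrite away_fracN away_fracD !away_lift_frac rmorphD !rmorphM rmorphN !rmorphXn.
have fuX i : f d ^+ i * u ^+ i = 1 by rewrite -exprMn fu expr1n.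
rewrite exprD /=.
transitivity (f a * u ^+ k * (f d ^+ m * u ^+ m) -
              f b * u ^+ m * (f d ^+ k * u ^+ k)); first by ring.
by rewrite !fuX !mulr1.
Qed.

Lemma away_lift_monoid : monoid_morphism (away_lift fu).
Proof.
split; first by rewrite away_lift_frac rmorph1 mulr1.
elim/away_ind=> a k; elim/away_ind=> b m.
by rewrite away_fracM !away_lift_frac rmorphM exprD; ring.
Qed.

HB.instance Definition _ :=
  GRing.isZmodMorphism.Build (away hd) T (away_lift fu) away_lift_zmod.
HB.instance Definition _ :=
  GRing.isMonoidMorphism.Build (away hd) T (away_lift fu) away_lift_monoid.

End AwayLift.

Section Algebras.
Context (R : comNzRingType) (q : nat) (lam : R).

(* The polynomial ring R[X_{T^0}, ..., X_{T^(q-1)}] is {mpoly R[q]}; [mpvar s]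
   is the variable of index s.  The value 0 for s >= q is never used when
   1 < q. *)
Definition mpvar (s : nat) : {mpoly R[q]} :=
  if (insub s : option 'I_q) is Some i then 'X_i else 0.

Definition Delta : {mpoly R[q]} :=
  \prod_(l < q) \sum_(k < l.+1) (lam ^+ k *: mpvar k) *+ 'C(l, k).

Definition eval10 : {mpoly R[q]} -> R :=
  mmap idfun (fun i : 'I_q => ((i : nat) == 0%N)%:R).
HB.instance Definition _ := GRing.RMorphism.on eval10.

Lemma eval10_var s : eval10 (mpvar s) = ((s < q)%N && (s == 0%N))%:R.
Proof.
rewrite /eval10 /mpvar; case: insubP => [i lti vi|/negPf->]; last first.
  by rewrite raddf0.
by rewrite mmapX mmap1U vi lti.
Qed.

Lemma eval10Z c P : eval10 (c *: P) = c * eval10 P.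
Proof. exact: mmapZ. Qed.

Lemma nonnilp_eval10 P : eval10 P = 1 -> nonnilp P.
Proof.
move=> e k; apply/eqP => /(congr1 eval10)/eqP.
by rewrite rmorphXn /= e expr1n raddf0 oner_eq0.
Qed.

Lemma nonnilp_Delta : nonnilp Delta.
Proof.
apply: nonnilp_eval10; rewrite rmorph_prod big1 //= => l _.
rewrite raddf_sum big_ord_recl /= big1 => [|k _]; last first.
  by rewrite raddfMn /= eval10Z eval10_var /bump /= andbF mulr0 mul0rn.
rewrite addr0 raddfMn /= eval10Z eval10_var bin0 expr0 mul1r.
by case: q l => [[]|].
Qed.

(* The coordinate ring S(A)_Theta of the unit group scheme of the group algebra,
   where A = R[T]/(T^q) is truncAlg below. *)
Definition unitAlg := away nonnilp_Delta.
HB.instance Definition _ := GRing.ComAlgebra.on unitAlg.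

Definition Xvar (s : nat) : unitAlg := away_of nonnilp_Delta (mpvar s).

Definition truncAlg : Type := {poly %/ ('X^q : {poly R})}.
HB.instance Definition _ := GRing.ComAlgebra.on truncAlg.

Definition Tgen : truncAlg := in_qpoly 'X^q 'X.

(* The tensor product unitAlg ⊗_R A is the base change unitAlg[T]/(T^q), with
   b ⊗ a := [tens b a]; that this is the tensor product over R is [tens_universal] and
   [tensM]. *)
Definition tensAlg : Type := {poly %/ ('X^q : {poly unitAlg})}.
HB.instance Definition _ := GRing.ComAlgebra.on tensAlg.

Lemma in_truncX (B : comNzRingType) :
  in_qpoly ('X^q : {poly B}) 'X^(q.-1.+1) = 0.
Proof.
by apply: val_inj; rewrite /= mk_monic_Xn Pdiv.RingMonic.rmodpp ?monicXn.
Qed.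

Lemma in_trunc_map (B : comNzRingType) (f : {rmorphism R -> B}) (P : {poly R}) :
  in_qpoly ('X^q : {poly B}) (map_poly f (in_qpoly ('X^q : {poly R}) P)) =
  in_qpoly 'X^q (map_poly f P).
Proof.
have m_monic := monic_mk_monic ('X^q : {poly R}).
have m0 : in_qpoly ('X^q : {poly B}) (map_poly f (mk_monic 'X^q)) = 0.
  by rewrite mk_monic_Xn map_polyXn in_truncX.
have e := congr1 (map_poly f) (Pdiv.RingMonic.rdivp_eq m_monic P).
rewrite rmorphD rmorphM in e; rewrite [RHS](congr1 (in_qpoly _) e).
by rewrite [RHS]raddfD /= in_qpolyM m0 mulr0 add0r.
Qed.

Definition tens (b : unitAlg) (a : truncAlg) : tensAlg :=
  b *: in_qpoly 'X^q (map_poly (in_alg unitAlg) (a : {poly R})).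

Lemma tensZ b a : tens b a = b *: tens 1 a.
Proof. by rewrite /tens scale1r. Qed.

Lemma tens1_zmod : zmod_morphism (tens 1).
Proof. by move=> a a'; rewrite /tens !scale1r /= !raddfB. Qed.

Lemma tens1_monoid : monoid_morphism (tens 1).
Proof.
split=> [|a a']; rewrite /tens !scale1r /=; last first.
  by rewrite in_trunc_map !rmorphM.
by rewrite rmorph1 in_qpoly1.
Qed.

HB.instance Definition _ :=
  GRing.isZmodMorphism.Build truncAlg tensAlg (tens 1) tens1_zmod.
HB.instance Definition _ :=
  GRing.isMonoidMorphism.Build truncAlg tensAlg (tens 1) tens1_monoid.

Lemma tensM b a b' a' : tens b a * tens b' a' = tens (b * b') (a * a').
Proof.
rewrite tensZ [tens b' _]tensZ [RHS]tensZ rmorphM.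
by rewrite -scalerAl -scalerAr scalerA.
Qed.

Lemma tensDl a : {morph tens^~ a : b b' / b + b'}.
Proof. by move=> b b'; rewrite /tens scalerDl. Qed.

Lemma tensDr b : {morph tens b : a a' / a + a'}.
Proof. by move=> a a'; rewrite tensZ raddfD scalerDr -!tensZ. Qed.

Lemma tens_balanced (c : R) b a : tens (c *: b) a = tens b (c *: a).
Proof.
rewrite /tens; have -> : map_poly (in_alg unitAlg) ((c *: a : truncAlg) : {poly R}) =
    c%:A *: map_poly (in_alg unitAlg) (a : {poly R}).
  by rewrite -[LHS]/(map_poly (in_alg unitAlg) (c *: (a : {poly R}))) map_polyZ.
by rewrite in_qpolyZ scalerA mulr_algr.
Qed.

Lemma trunc_expand (B : comNzRingType) (x : {poly %/ ('X^q : {poly B})}) :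
  x = \sum_(i < q.-1.+1) (x : {poly B})`_i *: in_qpoly 'X^q 'X ^+ i.
Proof.
have sx : (size (x : {poly B}) <= q.-1.+1)%N.
  by rewrite -ltnS (leq_trans (size_mk_monic x)) // mk_monic_Xn size_polyXn.
rewrite [LHS](_ : x = in_qpoly 'X^q (x : {poly B})); last first.
  by apply: val_inj; rewrite [RHS]in_qpoly_small // size_mk_monic.
rewrite -[in LHS](_ : \poly_(i < q.-1.+1) (x : {poly B})`_i = x); last first.
  apply/polyP=> i; rewrite coef_poly; case: ltnP => // lei.
  by rewrite nth_default // (leq_trans sx).
rewrite poly_def raddf_sum; apply: eq_bigr => i _ /=.
by rewrite in_qpolyZ rmorphXn.
Qed.

Lemma tens1T : tens 1 Tgen = in_qpoly 'X^q 'X.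
Proof. by rewrite /tens scale1r /Tgen in_trunc_map map_polyX. Qed.

(* tensAlg, with tens, is the tensor product over R: it represents the
   R-balanced biadditive maps on unitAlg x A. *)
Lemma tens_universal (M : zmodType) (beta : unitAlg -> truncAlg -> M) :
  (forall b, {morph beta b : a a' / a + a'}) ->
  (forall a, {morph beta^~ a : b b' / b + b'}) ->
  (forall (c : R) b a, beta (c *: b) a = beta b (c *: a)) ->
  exists! g : tensAlg -> M,
    {morph g : x y / x + y} /\ forall b a, g (tens b a) = beta b a.
Proof.
move=> bDr bDl bZ.
have b0l a : beta 0 a = 0.
  by apply: (addrI (beta 0 a)); rewrite -bDl !addr0.
have b0r b : beta b 0 = 0.
  by apply: (addrI (beta b 0)); rewrite -bDr !addr0.
pose g (x : tensAlg) : M :=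
  \sum_(i < q.-1.+1) beta (x : {poly unitAlg})`_i (Tgen ^+ i).
have gD : {morph g : x y / x + y}.
  move=> x y; rewrite /g -big_split; apply: eq_bigr => i _ /=.
  by rewrite coefD bDl.
have coef_tens b a i : (tens b a : {poly unitAlg})`_i = (a : {poly R})`_i *: b.
  have e : in_qpoly ('X^q : {poly unitAlg}) (map_poly (in_alg _) (a : {poly R}))
      = map_poly (in_alg unitAlg) (a : {poly R}) :> {poly unitAlg}.
    apply: in_qpoly_small; rewrite (leq_ltn_trans (size_poly _ _)) //.
    by rewrite (leq_trans (size_mk_monic a)) // !mk_monic_Xn !size_polyXn.
  transitivity (b * (in_qpoly ('X^q : {poly unitAlg})
    (map_poly (in_alg _) (a : {poly R})) : {poly unitAlg})`_i); first exact: coefZ.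
  by rewrite e coef_map /= mulr_algr.
have gT b a : g (tens b a) = beta b a.
  rewrite [in RHS](trunc_expand a) (big_morph _ (bDr b) (b0r b)).
  by apply: eq_bigr => i _; rewrite coef_tens bZ.
exists g; split=> // h [hD hT]; apply: funext => x.
have h0 : h 0 = 0 by apply: (addrI (h 0)); rewrite -hD !addr0.
rewrite [in RHS](trunc_expand x) (big_morph _ hD h0) /g.
apply: eq_bigr => i _; rewrite -hT [tens _ _]tensZ.
by rewrite rmorphXn /= tens1T.
Qed.

(* rho(X_{T^s}) *)
Definition rho_var (s : nat) : tensAlg :=
  \sum_(l < s.+1)
    tens (\sum_(k < l.+1) (lam ^+ k *: Xvar (k + (s - l))) *+ 'C(l, k)) (Tgen ^+ l)
      *+ 'C(s, l).

Definition tensC (r : R) : tensAlg := qpolyC 'X^q (in_alg unitAlg r).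
HB.instance Definition _ := GRing.RMorphism.copy tensC
  (qpolyC ('X^q : {poly unitAlg}) \o in_alg unitAlg).

Definition rho_poly : {mpoly R[q]} -> tensAlg :=
  mmap tensC (fun i : 'I_q => rho_var i).
HB.instance Definition _ := GRing.RMorphism.on rho_poly.

Lemma rho_poly_var s : (s < q)%N -> rho_poly (mpvar s) = rho_var s.
Proof.
rewrite /rho_poly /mpvar => ltsq; case: insubP => [i _ <-|/negP//].
by rewrite mmapX mmap1U.
Qed.

Lemma rho_polyZ c P : rho_poly (c *: P) = tensC c * rho_poly P.
Proof. exact: mmapZ. Qed.

Lemma tensCE b a : tens b a = qpolyC 'X^q b * tens 1 a.
Proof.
have -> : qpolyC 'X^q b = b *: (1 : tensAlg).
  by apply: val_inj; rewrite /= -mul_polyC mulr1.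
by rewrite mulr_algl -tensZ.
Qed.

Lemma tensr1 b : tens b 1 = qpolyC 'X^q b.
Proof. by rewrite tensCE rmorph1 mulr1. Qed.

Let rho_poly_factor l : (l < q)%N ->
  rho_poly (\sum_(k < l.+1) (lam ^+ k *: mpvar k) *+ 'C(l, k)) =
  tens (away_of nonnilp_Delta (\sum_(k < l.+1) (lam ^+ k *: mpvar k) *+ 'C(l, k)))
       ((1 + lam *: Tgen) ^+ l).
Proof.
move=> ltlq; rewrite raddf_sum.
pose Y m := qpolyC 'X^q (Xvar m) : tensAlg.
have YE s j : qpolyC 'X^q
    (\sum_(k < j.+1) (lam ^+ k *: Xvar (k + s)) *+ 'C(j, k)) =
    \sum_(k < j.+1) (tensC lam ^+ k * Y (k + s)%N) *+ 'C(j, k).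
  rewrite raddf_sum; apply: eq_bigr => k _.
  rewrite raddfMn /= -mulr_algl rmorphM -/(Y _) -rmorphXn.
  by congr (_ * _ *+ _).
transitivity (\sum_(s < l.+1) (tensC lam ^+ s * (\sum_(j < s.+1)
      (\sum_(k < j.+1) (tensC lam ^+ k * Y (k + (s - j))%N) *+ 'C(j, k))
        * (tens 1 Tgen) ^+ j *+ 'C(s, j))) *+ 'C(l, s)).
  apply: eq_bigr => s _.
  rewrite raddfMn /= rho_polyZ rmorphXn rho_poly_var; last first.
    by rewrite (leq_ltn_trans _ ltlq) // -ltnS.
  congr (_ * _ *+ _); apply: eq_bigr => j _.
  by rewrite tensCE YE rmorphXn.
rewrite umbral [RHS]tensCE mulrC [tens 1 (_ ^+ l)]rmorphXn rmorphD rmorph1; congr (_ * _ ^+ _).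
  have := YE 0%N l; rewrite raddf_sum => e.
  transitivity (\sum_(k < l.+1) (tensC lam ^+ k * Y (k + 0)%N) *+ 'C(l, k)).
    by apply: eq_bigr => k _; rewrite addn0.
  rewrite -YE; congr (qpolyC _ _); rewrite raddf_sum; apply: eq_bigr => k _.
  by rewrite raddfMn addn0 /= [in RHS]away_of_scalable.
congr (1 + _); rewrite -[RHS]/(tens 1 (lam *: Tgen)) -tens_balanced [RHS]tensCE.
by congr (_ * _).
Qed.

Definition rho_inv : tensAlg :=
  tens (away_frac nonnilp_Delta 1 1)
    ((\sum_(i < q.-1.+1) (- (lam *: Tgen)) ^+ i) ^+ \sum_(l < q) l).

Lemma rho_Delta_unit : rho_poly Delta * rho_inv = 1.
Proof.
have -> : rho_poly Delta =
    tens (away_of _ Delta) ((1 + lam *: Tgen) ^+ \sum_(l < q) l).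
  rewrite rmorph_prod (eq_bigr _ (fun l _ => rho_poly_factor (ltn_ord l))).
  rewrite [in RHS]/Delta rmorph_prod -prodrXr.
  pose K (x : tensAlg) b a := x = tens b a.
  apply: (big_rec3 K) => [|i x b a _ ->]; first by rewrite /K tensr1 rmorph1.
  by rewrite /K tensM.
rewrite /rho_inv tensM -exprMn.
have -> : (1 + lam *: Tgen) * (\sum_(i < q.-1.+1) (- (lam *: Tgen)) ^+ i) = 1.
  have := subrX1 (- (lam *: Tgen)) q.-1.+1.
  have T0 : Tgen ^+ q.-1.+1 = 0 by rewrite /Tgen -rmorphXn /= in_truncX.
  rewrite exprNn exprZn T0 scaler0 mulr0 sub0r.
  by rewrite -opprD mulNr [_ + 1]addrC => /oppr_inj <-.
by rewrite expr1n away_of_inv tensr1 rmorph1.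
Qed.

Definition rho : unitAlg -> tensAlg :=
  @away_lift _ _ _ nonnilp_Delta rho_poly _ rho_Delta_unit.
HB.instance Definition _ := GRing.RMorphism.on rho.

Lemma rho_Xvar s : (s < q)%N -> rho (Xvar s) = rho_var s.
Proof. by move=> ltsq; rewrite -rho_poly_var //; exact: away_lift_of. Qed.

Lemma rho_scale (c : R) (b : unitAlg) : rho (c *: b) = (c%:A : unitAlg) *: rho b.
Proof.
have -> : c *: b = away_of nonnilp_Delta c%:A * b by [].
have rc : rho (away_of nonnilp_Delta c%:A) = tensC c.
  by rewrite /rho away_lift_of [LHS]rho_polyZ rmorph1 mulr1.
rewrite rmorphM /= rc.
by rewrite -[tensC c]tensr1 tensZ rmorph1 mulr_algl.
Qed.

Definition coinv : {pred unitAlg} := [pred b | rho b == tens b 1].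

Lemma coinv_subalg : subalg_closed coinv.
Proof.
have cP b : (b \in coinv) = (rho b == tens b 1) by [].
split=> [|c a b|a b]; rewrite !cP.
- by rewrite !rmorph1.
- move=> /eqP ea /eqP eb; rewrite rmorphD /= rho_scale ea eb tensDl.
  by rewrite [tens a 1]tensZ [tens (c *: a) 1]tensZ scalerA mulr_algl.
- by move=> /eqP ea /eqP eb; rewrite rmorphM /= ea eb tensM mulr1.
Qed.

Definition coinvAlg : Type := {b : unitAlg | b \in coinv}.
HB.instance Definition _ := [isSub of coinvAlg for @sval _ _].
HB.instance Definition _ := [Choice of coinvAlg by <:].
HB.instance Definition _ := GRing.SubChoice_isSubAlgebra.Build R unitAlg
  coinv coinvAlg (GRing.subalg_closed_semi coinv_subalg).
HB.instance Definition _ := [SubNzRing_isSubComNzRing of coinvAlg by <:].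

Lemma pexpn_gt0 (p n : nat) : prime p -> (0 < p ^ n)%N.
Proof. by move=> p_pr; rewrite expn_gt0 prime_gt0. Qed.

(* R[Z_1, Z_T, ..., Z_{T^(q-1)}] is {mpoly R[q]}: Z_1 is the variable of index
   0, and Z_{T^k} the one of index k. *)
Definition Epoly (s : nat) : {mpoly R[q]} :=
  mpvar 0 ^+ s
  + \sum_(2 <= k < s) (lam ^+ k *: (mpvar 0 ^+ (s - k) * mpvar k)) *+ 'C(s, k)
  + lam ^+ s *: mpvar s.

(* The product of all the elements inverted in the source algebra; inverting it
   amounts to inverting each of them. *)
Definition quotDen : {mpoly R[q]} :=
  mpvar 0 * (mpvar 0 ^+ q + lam ^+ q *: mpvar 1) * \prod_(2 <= s < q) Epoly s.

Lemma nonnilp_quotDen : (0 < q)%N -> nonnilp quotDen.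
Proof.
move=> q_gt0; have e0 : eval10 (mpvar 0) = 1 by rewrite eval10_var q_gt0.
have eS k : eval10 (mpvar k.+1) = 0 by rewrite eval10_var andbF.
apply: nonnilp_eval10; rewrite !rmorphM rmorphD rmorphXn /= eval10Z e0 eS.
rewrite expr1n mulr0 addr0 !mul1r rmorph_prod big_nat_cond big1 //= => s.
rewrite andbT => /andP[]; case: s => // s _ _.
rewrite !rmorphD rmorphXn /= e0 eval10Z eS mulr0 addr0 expr1n raddf_sum.
rewrite big_nat_cond big1 ?addr0 // => k; rewrite andbT => /andP[].
case: k => // k _ _.
by rewrite raddfMn /= eval10Z rmorphM /= eS !mulr0 mul0rn.
Qed.

Definition quotAlg (q_gt0 : (0 < q)%N) := away (nonnilp_quotDen q_gt0).
HB.instance Definition _ (q_gt0 : (0 < q)%N) := GRing.ComAlgebra.on (quotAlg q_gt0).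

End Algebras.

(* Main.v *)
(** For a sequence X of symbols X_s standing for T^s, let aff u v X be the sequence
    standing for (u + v T)^s.  With w = X_1 / X_0 and g = 1 + lam w, translating
    the universal unit by the inverse of w gives the sequence
    Y = aff (-w/g) (1/g) X, with Y_0 = X_0 and Y_1 = 0, and its members are
    coinvariant, as are X_0 and X_1^q where q = p^n.  The isomorphism phi sends
    Z_0 to X_0, Z_1 to X_1^q and Z_s to X_0^(s-1) Y_s.

    Adjoining to the source C a root w of w^q = Z_1 / Z_0^q recovers the unit
    algebra S through X = aff w g Y; so phi is injective, and each b in S is F(w)
    for a polynomial F of degree < q with coefficients in the image of phi.  As
    rho(w) = w + g T, coinvariance of b reads F(w + g T) = b, which forces F = b
    to be constant. *)

From HB Require Import structures.
Require Import Defs.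
From mathcomp Require Import all_boot all_algebra.
From mathcomp Require Import boolp mpoly ring.

Import GRing.Theory.
Local Open Scope ring_scope.

(** * Affine substitutions T -> u + v T in sequences of symbolic powers *)

Definition aff {B : comNzRingType} (u v : B) (X : nat -> B) (s : nat) : B :=
  \sum_(j < s.+1) (u ^+ (s - j) * v ^+ j * X j) *+ 'C(s, j).

(* The linear map T^s |-> X s. *)
Definition umbra {B : comNzRingType} (X : nat -> B) (P : {poly B}) : B :=
  \sum_(i < size P) P`_i * X i.

Definition affp {B : comNzRingType} (u v : B) : {poly B} := u%:P + v *: 'X.

Section Umbra.
Context {B : comNzRingType}.
Implicit Types (u v c : B) (X : nat -> B) (P Q : {poly B}).

Lemma umbra_widen X n P : (size P <= n)%N -> umbra X P = \sum_(i < n) P`_i * X i.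
Proof.
move=> sP; rewrite /umbra (big_ord_widen n (fun i => P`_i * X i)) // big_mkcond.
by apply: eq_bigr => i _; case: ltnP => // /(nth_default 0)->; rewrite mul0r.
Qed.

Lemma umbra_linear X : linear_for *%R (umbra X).
Proof.
move=> c P Q; pose n := maxn (size (c *: P + Q)) (maxn (size P) (size Q)).
rewrite !(umbra_widen X n) ?leq_max ?leqnn ?orbT // mulr_sumr -big_split /=.
by apply: eq_bigr => i _; rewrite coefD coefZ mulrDl mulrA.
Qed.

HB.instance Definition _ X :=
  GRing.isLinear.Build B {poly B} B *%R (umbra X) (umbra_linear X).

Lemma umbraZ X c P : umbra X (c *: P) = c * umbra X P.
Proof. exact: linearZ. Qed.

Lemma umbraXn X m : umbra X 'X^m = X m.
Proof.
rewrite (umbra_widen X m.+1) ?size_polyXn // big_ord_recr /= coefXn eqxx mul1r.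
by rewrite big1 ?add0r // => i _; rewrite coefXn (ltn_eqF (ltn_ord i)) mul0r.
Qed.

Lemma umbra_affp u v X s : umbra X (affp u v ^+ s) = aff u v X s.
Proof.
rewrite exprDn raddf_sum; apply: eq_bigr => j _; rewrite raddfMn /=.
by rewrite exprZn -polyC_exp -scalerAr mul_polyC !umbraZ umbraXn; congr (_ *+ _); ring.
Qed.

Lemma umbra_aff u v X P : umbra (aff u v X) P = umbra X (P \Po affp u v).
Proof.
rewrite comp_polyE raddf_sum; apply: eq_bigr => i _.
by rewrite /= umbraZ umbra_affp.
Qed.

Lemma affp_comp u v u' v' :
  affp u v \Po affp u' v' = affp (u + v * u') (v * v').
Proof.
rewrite /affp comp_polyD comp_polyC comp_polyZ comp_polyX scalerDr scalerA.
by rewrite -mul_polyC -polyCM addrA -polyCD.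
Qed.

(** By [umbra_aff], substituting twice in the symbol amounts to composing two polynomials [affp], so
    the parameters multiply as in the affine group. *)
Lemma aff_aff u v u' v' X s :
  aff u v (aff u' v' X) s = aff (u + v * u') (v * v') X s.
Proof.
by rewrite -umbra_affp umbra_aff rmorphXn /= affp_comp umbra_affp.
Qed.

Lemma eq_aff u v X X' s : (forall j, (j <= s)%N -> X j = X' j) ->
  aff u v X s = aff u v X' s.
Proof. by move=> e; apply: eq_bigr => j _; rewrite e // -ltnS. Qed.

Lemma aff_id X s : aff 0 1 X s = X s.
Proof.
by rewrite -umbra_affp /affp scale1r polyC0 add0r umbraXn.
Qed.

Lemma aff0 u v X : aff u v X 0 = X 0%N.
Proof. by rewrite /aff big_ord1 subnn !expr0 !mul1r mulr1n. Qed.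

Lemma aff1 u v X : aff u v X 1 = u * X 0%N + v * X 1%N.
Proof. by rewrite /aff !big_ord_recl big_ord0 /= /bump /= !bin0 !binn; ring. Qed.

Lemma affMl c u v X s : aff (c * u) (c * v) X s = c ^+ s * aff u v X s.
Proof.
rewrite -!umbra_affp -umbraZ -exprZn /=.
by rewrite /affp scalerDr scalerA polyCM mul_polyC.
Qed.

(** The grouping u + (1 + v u) T = T + u (1 + v T), expanded binomially. For v = lam the right-hand
    side has the shape of the formula that defines rho(X_{T^s}). *)
Lemma aff_taylor u v X s : aff u (1 + v * u) X s =
  \sum_(l < s.+1) (u ^+ l * \sum_(k < l.+1) (v ^+ k * X (k + (s - l))%N) *+ 'C(l, k))
    *+ 'C(s, l).
Proof.
have -> : aff u (1 + v * u) X s = umbra X (('X + u *: affp 1 v) ^+ s).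
  rewrite -umbra_affp; congr (umbra _ (_ ^+ s)).
  rewrite /affp scalerDr -[u%:P]mulr1 mul_polyC scalerA scalerDl scale1r polyC1.
  by rewrite addrCA [u * v]mulrC.
rewrite exprDn raddf_sum; apply: eq_bigr => l _; rewrite raddfMn /=.
rewrite exprZn -scalerAr umbraZ; congr (_ * _ *+ _).
rewrite /affp exprDn (mulr_sumr _ _ _ 'X^(s - l)) raddf_sum; apply: eq_bigr => k _.
rewrite mulrnAr raddfMn /= polyC1 expr1n mul1r exprZn -scalerAr umbraZ.
by rewrite -exprD umbraXn addnC.
Qed.

End Umbra.

Lemma rmorph_aff {B B' : comNzRingType} (f : {rmorphism B -> B'}) u v X s :
  f (aff u v X s) = aff (f u) (f v) (f \o X) s.
Proof.
rewrite rmorph_sum; apply: eq_bigr => j _.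
by rewrite rmorphMn /= !rmorphM /= !rmorphXn.
Qed.

(** * Invertible elements *)

Definition invertible {B : comNzRingType} (a : B) := exists b, a * b = 1.

Section Invertible.
Context {B : comNzRingType}.

Lemma invertible1 : invertible (1 : B).
Proof. by exists 1; rewrite mulr1. Qed.

Lemma invertibleMP (a b : B) : invertible (a * b) <-> invertible a /\ invertible b.
Proof.
split=> [[c e]|[[c e] [c' e']]].
  by split; [exists (b * c) | exists (a * c)]; rewrite -e; ring.
by exists (c * c'); rewrite mulrACA e e' mulr1.
Qed.

Lemma invertibleX (a : B) n : invertible a -> invertible (a ^+ n).
Proof. by case=> b e; exists (b ^+ n); rewrite -exprMn e expr1n. Qed.

Lemma invertibleX_inv (a : B) n : (0 < n)%N -> invertible (a ^+ n) -> invertible a.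
Proof. by case: n => // n _; rewrite exprS => /invertibleMP[]. Qed.

Lemma invertible_prodP (I : eqType) (r : seq I) (F : I -> B) :
  invertible (\prod_(i <- r) F i) <-> {in r, forall i, invertible (F i)}.
Proof.
elim: r => [|j r IH]; first by rewrite big_nil; split=> // _; exact: invertible1.
rewrite big_cons invertibleMP IH; split=> [[Fj Fr] i|Fr].
  by rewrite inE => /predU1P[->|/Fr].
by split=> [|i ri]; apply: Fr; rewrite inE ?eqxx ?ri ?orbT.
Qed.

End Invertible.

Lemma invertible_rmorph {B B' : comNzRingType} (f : {rmorphism B -> B'}) a :
  invertible a -> invertible (f a).
Proof. by case=> b e; exists (f b); rewrite -rmorphM e rmorph1. Qed.

(** * Evaluation of the denominators, and localizations by their universal property *)

Definition ev {R T : comNzRingType} {q} (f : R -> T) (y : nat -> T) :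
  {mpoly R[q]} -> T := mmap f (fun i : 'I_q => y i).

Section Evaluation.
Context {R T : comNzRingType} {q : nat} (f : {rmorphism R -> T}) (y : nat -> T).
Local Notation ev := (@ev R T q f y).
HB.instance Definition _ := GRing.RMorphism.on ev.

Lemma ev_var s : (s < q)%N -> ev (mpvar R q s) = y s.
Proof.
rewrite /ev /mpvar => ltsq; case: insubP => [i _ <-|/negP//].
by rewrite mmapX mmap1U.
Qed.

Lemma evZ c P : ev (c *: P) = f c * ev P.
Proof. exact: mmapZ. Qed.

Lemma ev_unique (h : {rmorphism {mpoly R[q]} -> T}) :
  (forall c, h c%:MP = f c) -> (forall s, (s < q)%N -> h (mpvar R q s) = y s) ->
  h =1 ev.
Proof.
move=> hC hX P; rewrite [in LHS](mpolyE P) rmorph_sum; apply: eq_bigr => m _ /=.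
rewrite -mul_mpolyC rmorphM /= hC mpolyXE_id rmorph_prod; congr (_ * _).
apply: eq_bigr => i _; rewrite rmorphXn -hX //=; congr (h _ ^+ _).
by rewrite /mpvar valK.
Qed.

(** The factor of index l of [Delta] is the symbol of (1 + lam T)^l. *)
Lemma ev_Delta lam : ev (Delta q lam) = \prod_(0 <= l < q) aff 1 (f lam) y l.
Proof.
rewrite rmorph_prod big_mkord; apply: eq_bigr => l _ /=; rewrite raddf_sum.
apply: eq_bigr => k _; rewrite raddfMn /= evZ ev_var; last first.
  by rewrite (leq_ltn_trans _ (ltn_ord l)) // -ltnS.
by rewrite rmorphXn expr1n mul1r.
Qed.

(** With Z_k = Y_0^(k-1) Y_k, each term of E_s carries the factor Y_0^(s-1). What is left is the
    expansion of (1 + lam T)^s, whose linear term is absent from E_s and vanishes on the right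
    because Y_1 = 0. *)
Lemma ev_Epoly lam (Y : nat -> T) s : (1 < s < q)%N ->
  y 0%N = Y 0%N -> Y 1%N = 0 ->
  (forall k, (1 < k < q)%N -> y k = Y 0%N ^+ k.-1 * Y k) ->
  ev (Epoly q lam s) = Y 0%N ^+ s.-1 * aff 1 (f lam) Y s.
Proof.
case/andP=> s_gt1 ltsq y0 Y1 yY; rewrite /aff; under eq_bigr do rewrite expr1n mul1r.
rewrite -(big_mkord xpredT (fun j => (f lam ^+ j * Y j) *+ 'C(s, j))).
rewrite big_nat_recr //= big_ltn 1?ltnW // big_ltn // Y1 mulr0 mul0rn add0r.
rewrite bin0 binn !mulr1n expr0 mul1r !mulrDr -exprSr prednK 1?ltnW //.
rewrite !rmorphD rmorphXn /= evZ rmorphXn /= !ev_var // ?y0 ?yY ?s_gt1 //; last first.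
  by rewrite (ltn_trans _ ltsq) 1?ltnW.
congr (_ + _ + _); last by ring.
rewrite rmorph_sum mulr_sumr big_nat_cond [RHS]big_nat_cond; apply: eq_bigr => k.
rewrite andbT => /andP[k_gt1 ltks].
have ltkq := ltn_trans ltks ltsq; have q_gt0 : (0 < q)%N by case: (q) ltkq.
rewrite rmorphMn /= evZ !rmorphM !rmorphXn /= !ev_var // y0 yY ?k_gt1 //.
rewrite mulrnAr; congr (_ *+ _).
have -> : s.-1 = (s - k + k.-1)%N by rewrite -!subn1 addnBA ?subnK // ltnW // ltnW.
by rewrite exprD; ring.
Qed.

Lemma ev_quotDenP lam (Y : nat -> T) : (1 < q)%N ->
  y 0%N = Y 0%N -> Y 1%N = 0 ->
  (forall k, (1 < k < q)%N -> y k = Y 0%N ^+ k.-1 * Y k) ->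
  invertible (ev (quotDen q lam)) <->
  [/\ invertible (Y 0%N), invertible (Y 0%N ^+ q + f lam ^+ q * y 1%N) &
      forall s, (1 < s < q)%N -> invertible (aff 1 (f lam) Y s)].
Proof.
move=> q_gt1 y0 Y1 yY; rewrite /quotDen !rmorphM rmorphD rmorphXn /= evZ rmorphXn /=.
rewrite !ev_var ?y0 //; last exact: ltnW.
rewrite rmorph_prod !invertibleMP invertible_prodP; split=> [[[iY0 iD] iE]|[iY0 iD iY]].
  split=> // s ltsq; have := iE s; rewrite mem_index_iota ltsq /= => /(_ isT).
  by rewrite (ev_Epoly lam Y s) // => /invertibleMP[].
split=> // s; rewrite mem_index_iota => ltsq /=; rewrite (ev_Epoly lam Y s) //.
by apply/invertibleMP; split; [exact: invertibleX | exact: iY].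
Qed.

End Evaluation.

(* S, with its structure map i and the elements x s, is the localization of
   R[x_0, ..., x_(q-1)] at d. *)
Definition presents {R S : comNzRingType} {q} (i : {rmorphism R -> S})
    (x : nat -> S) (d : {mpoly R[q]}) :=
  [/\ invertible (ev i x d),
      forall (T : comNzRingType) (f : {rmorphism R -> T}) (y : nat -> T),
        invertible (ev f y d) ->
        exists g : {rmorphism S -> T},
          (forall c, g (i c) = f c) /\ forall s, (s < q)%N -> g (x s) = y s
    & forall (T : comNzRingType) (g g' : {rmorphism S -> T}),
        (forall c, g (i c) = g' (i c)) ->
        (forall s, (s < q)%N -> g (x s) = g' (x s)) -> g =1 g'].

Lemma away_presents (R : comNzRingType) q (d : {mpoly R[q]}) (hd : nonnilp d) :
  presents (in_alg (away hd)) (fun s => away_of hd (mpvar R q s)) d.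
Proof.
have away_ofC c : away_of hd c%:MP = in_alg (away hd) c.
  by rewrite /= -[c%:MP]mulr1 mul_mpolyC linearZ rmorph1.
split=> [|T f y [u fu]|T g g' eC eX].
- by exists (away_frac hd 1 1); rewrite -(ev_unique _ _ (away_of hd)) ?away_of_inv.
- exists (away_lift fu); split=> [c|s ltsq].
    apply: etrans (congr1 (away_lift fu) (esym (away_ofC c))) _.
    by rewrite away_lift_of; exact: mmapC.
  by apply: etrans (away_lift_of hd fu _) _; exact: ev_var.
- have eP P : g (away_of hd P) = g' (away_of hd P).
    pose h (k : {rmorphism away hd -> T}) : {rmorphism {mpoly R[q]} -> T} :=
      k \o away_of hd.
    rewrite -[LHS]/(h g P) -[RHS]/(h g' P).
    pose f : {rmorphism R -> T} := g' \o in_alg (away hd).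
    rewrite (ev_unique f (h g' \o mpvar R q) (h g)) //; last first.
      by move=> c; rewrite /= away_ofC eC.
    by rewrite (ev_unique f (h g' \o mpvar R q) (h g')) // => c; rewrite /= away_ofC.
  (* A fraction is a numerator times a power of 1/d, and agreement on d forces agreement on its
     inverse. *)
  elim/away_ind => a k; rewrite away_fracE !rmorphM !rmorphXn /= eP.
  congr (_ * _ ^+ _); set b := away_frac hd 1 1.
  have inv (h : {rmorphism away hd -> T}) : h (away_of hd d) * h b = 1.
    by rewrite -rmorphM /b away_of_inv rmorph1.
  by rewrite -[LHS]mulr1 -(inv g') mulrA -eP [g b * _]mulrC inv mul1r.
Qed.

Lemma inverse_unique {B : comNzRingType} (a b c : B) : a * b = 1 -> a * c = 1 -> b = c.
Proof. by move=> ab ac; rewrite -[b]mulr1 -ac mulrCA mulrA ab mul1r. Qed.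

(** * Evaluation of A[T]/(h) at a root of h *)

Section QpolyEval.
Context {A B : comNzRingType} (h : {poly A}) (f : {rmorphism A -> B}) (w : B).
Hypothesis hw : (map_poly f (mk_monic h)).[w] = 0.

(** The proof that w is a root is an argument, so that the morphism instances can be attached to the
    function. *)
Definition qpoly_eval of (map_poly f (mk_monic h)).[w] = 0 :=
  fun P : {poly %/ h} => (map_poly f (P : {poly A})).[w].
Local Notation theta := (qpoly_eval hw).

Lemma qpoly_eval_in P : theta (in_qpoly h P) = (map_poly f P).[w].
Proof.
rewrite [in RHS](Pdiv.RingMonic.rdivp_eq (monic_mk_monic h) P).
by rewrite rmorphD rmorphM hornerD hornerM hw mulr0 add0r.
Qed.

Lemma qpoly_evalC a : theta (qpolyC h a) = f a.
Proof. by rewrite /qpoly_eval qpolyCE map_polyC hornerC. Qed.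

Lemma in_qpolyK (P : {poly %/ h}) : in_qpoly h (P : {poly A}) = P.
Proof. by apply: val_inj; rewrite [LHS]in_qpoly_small // size_mk_monic. Qed.

Lemma qpoly_eval_zmod : zmod_morphism theta.
Proof. by move=> P Q; rewrite /qpoly_eval !raddfB hornerD hornerN. Qed.

Lemma qpoly_eval_monoid : monoid_morphism theta.
Proof.
split=> [|P Q]; first by rewrite -(in_qpoly1 h) qpoly_eval_in rmorph1 hornerC.
rewrite -[P in LHS]in_qpolyK -[Q in LHS]in_qpolyK -in_qpolyM qpoly_eval_in.
by rewrite rmorphM hornerM.
Qed.

HB.instance Definition _ :=
  GRing.isZmodMorphism.Build {poly %/ h} B theta qpoly_eval_zmod.
HB.instance Definition _ :=
  GRing.isMonoidMorphism.Build {poly %/ h} B theta qpoly_eval_monoid.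

End QpolyEval.

(** * Normalized coordinates and the map from C to S *)

Section Core.
Context {R S C : comNzRingType} {p n : nat} (p_pr : prime p) (n_gt0 : (0 < n)%N).
Context (charRp : p \in [pchar R]) (lam : R).
Local Notation q := (p ^ n)%N.
Context (i : {rmorphism R -> S}) (x : nat -> S) (hS : presents i x (Delta q lam)).
Context (j : {rmorphism R -> C}) (z : nat -> C) (hC : presents j z (quotDen q lam)).

Lemma pexpn_gt1 : (1 < q)%N.
Proof. by rewrite -[1%N](exp1n n) ltn_exp2r // prime_gt1. Qed.

(** The morphism from R gives T characteristic p. *)
Lemma frobeniusD {T : comNzRingType} (f : {rmorphism R -> T}) (a b : T) :
  (a + b) ^+ q = a ^+ q + b ^+ q.
Proof.
apply: exprDn_pchar; rewrite pnatX; apply/orP; left.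
by rewrite pnatE // (rmorph_pchar f).
Qed.

Lemma Delta_factor_invertible s : (s < q)%N -> invertible (aff 1 (i lam) x s).
Proof.
case: hS => [+ _ _]; rewrite ev_Delta => /invertible_prodP iD ltsq.
by apply: iD; rewrite mem_index_iota.
Qed.

Context (x0i gi : S).
Let w := x 1%N * x0i.
Let g := 1 + i lam * w.
Context (x0K : x 0%N * x0i = 1) (gK : g * gi = 1).

(* -w/g is the inverse of w for u + v + lam u v, the group law of Gamma, although w
   is no point of Gamma since w^q is not 0. *)
Definition normal_coord s := aff (- (w * gi)) gi x s.
Local Notation Y := normal_coord.

Lemma normal_coord0 : Y 0 = x 0%N. Proof. exact: aff0. Qed.

Lemma normal_coord1 : Y 1 = 0.
Proof.
rewrite /normal_coord aff1 /w.
transitivity (gi * x 1%N * (1 - x 0%N * x0i)); first by ring.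
by rewrite x0K; ring.
Qed.

(** The substitutions with parameters (w, g) and (-w/g, 1/g) are inverse to each other. *)
Lemma aff_normal_coord s : aff w g Y s = x s.
Proof.
rewrite aff_aff -[RHS]aff_id gK; congr (aff _ _ _ _).
by transitivity (w * (1 - g * gi)); [ring | rewrite gK; ring].
Qed.

(** Since 1 - lam w/g = 1/g, the substitution turns 1 + lam T into (1 + lam T)/g. *)
Lemma aff1_normal_coord s : aff 1 (i lam) Y s = gi ^+ s * aff 1 (i lam) x s.
Proof.
rewrite aff_aff -affMl; congr (aff _ _ _ _); last by rewrite mulrC.
by transitivity (g * gi - i lam * w * gi); [rewrite gK | rewrite /g]; ring.
Qed.

Definition quot_coord s :=
  if s is k.+1 then if k is 0 then x 1%N ^+ q else x 0%N ^+ k * Y s else x 0%N.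

Lemma quot_coordE s : (1 < s)%N -> quot_coord s = Y 0 ^+ s.-1 * Y s.
Proof. by case: s => // -[|s] // _; rewrite normal_coord0. Qed.

Lemma quot_map_exists : exists phi : {rmorphism C -> S},
  (forall c, phi (j c) = i c) /\ forall s, (s < q)%N -> phi (z s) = quot_coord s.
Proof.
case: hC => _ + _; apply; have q_gt1 := pexpn_gt1.
apply/(ev_quotDenP _ _ _ Y) => //; rewrite ?normal_coord0 ?normal_coord1 //.
  by move=> k /andP[k_gt1 _]; rewrite -normal_coord0; exact: quot_coordE.
split=> [||s /andP[s_gt1 ltsq]]; first by exists x0i.
  (* X_0^q + lam^q X_1^q is the q-th power of X_0 + lam X_1, the factor of index 1 of [Delta]. *)
  rewrite /= -exprMn -(frobeniusD i); apply: invertibleX.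
  by have := Delta_factor_invertible _ q_gt1; rewrite aff1 mul1r.
rewrite aff1_normal_coord; apply/invertibleMP; split; last exact: Delta_factor_invertible.
by apply: invertibleX; exists g; rewrite mulrC.
Qed.

Context (z0i : C) (z0K : z 0%N * z0i = 1).

(** The sequence Y rebuilt inside C. Its entry 0 at index 1 mirrors Y_1 = 0: the coordinate Z_1
    enters only through the root v below. *)
Definition unit_coord s :=
  if s is k.+1 then if k is 0 then 0 else z0i ^+ k * z s else z 0%N.

Lemma unit_coordE s : (1 < s)%N -> z s = unit_coord 0 ^+ s.-1 * unit_coord s.
Proof. by case: s => // -[|s] // _; rewrite mulrA -exprMn z0K expr1n mul1r. Qed.

(** * Maps out of S, given a root of w^q = Z_1 / Z_0^q *)

Section UnitMap.
Context {B : comNzRingType} (k : {rmorphism C -> B}) (v : B).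
Hypothesis kv : k (z 0%N) ^+ q * v ^+ q = k (z 1%N).
Let l := k (j lam).

Lemma unit_map_exists : exists psi : {rmorphism S -> B},
  (forall c, psi (i c) = k (j c)) /\
  forall s, (s < q)%N -> psi (x s) = aff v (1 + l * v) (k \o unit_coord) s.
Proof.
case: hS => _ + _; have q_gt1 := pexpn_gt1; pose f : {rmorphism R -> B} := k \o j.
move=> /(_ B f); apply; rewrite ev_Delta; apply/invertible_prodP => s.
rewrite mem_index_iota => /andP[_ ltsq] /=.
have [i0 iq iE] := (ev_quotDenP j z lam unit_coord q_gt1 erefl erefl
  (fun s h => unit_coordE s (proj1 (andP h)))).1 (let: And3 h _ _ := hC in h).
have kiY : invertible (aff 1 l (k \o unit_coord) s).
  (* [quotDen] contains E_s only for s >= 2; at s = 0 and s = 1 the factor is Y_0 itself, because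
     Y_1 = 0. *)
  case: s ltsq => [|[|s]] ltsq; rewrite ?aff0 ?aff1.
  - exact: invertible_rmorph.
  - by rewrite /= rmorph0 mulr0 addr0 mul1r; exact: invertible_rmorph.
  rewrite -[1](rmorph1 k) -rmorph_aff; apply: invertible_rmorph; exact: iE.
(* Substituting v + (1 + l v) T in 1 + l T gives (1 + l v)(1 + l T), so only 1 + l v remains to be
   inverted. *)
rewrite aff_aff (mulrC l (1 + _)) -[X in aff X]mulr1 affMl.
apply/invertibleMP; split=> //; apply: invertibleX.
apply: (@invertibleX_inv _ _ q); first exact: ltnW.
(* By Frobenius and [kv] this product is the image of Z_0^q + lam^q Z_1, which is inverted in C. *)
suff: invertible (k (z 0%N) ^+ q * (1 + l * v) ^+ q) by case/invertibleMP.
rewrite (frobeniusD f) expr1n exprMn mulrDr mulr1 mulrCA kv.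
rewrite -!rmorphXn -rmorphM -rmorphD.
by rewrite rmorphXn; exact: invertible_rmorph.
Qed.

(** It suffices to compare on the generators of C. There psi sends w to v, hence Y to [unit_coord],
    and X_1^q to Z_0^q v^q = Z_1. With k injective this makes phi injective. *)
Lemma unit_quot_map (psi : {rmorphism S -> B}) (phi : {rmorphism C -> S}) :
  (forall c, psi (i c) = k (j c)) ->
  (forall s, (s < q)%N -> psi (x s) = aff v (1 + l * v) (k \o unit_coord) s) ->
  (forall c, phi (j c) = i c) ->
  (forall s, (s < q)%N -> phi (z s) = quot_coord s) ->
  forall a, psi (phi a) = k a.
Proof.
move=> psiC psiX phiC phiZ a; have q_gt1 := pexpn_gt1.
case: hC => _ _ /(_ B (psi \o phi) k); apply=> [c|s ltsq] /=.
  by rewrite phiC psiC.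
have psi0 : psi (x 0%N) = k (z 0%N) by rewrite psiX ?aff0 // ltnW.
have psi1 : psi (x 1%N) = v * k (z 0%N) by rewrite psiX // aff1 /= rmorph0 mulr0 addr0.
have psiw : psi w = v.
  by rewrite rmorphM psi1 -psi0 -mulrA -rmorphM x0K rmorph1 mulr1.
have psig : psi g = 1 + l * v by rewrite rmorphD rmorph1 rmorphM psiC psiw.
have psiK : (1 + l * v) * psi gi = 1 by rewrite -psig -rmorphM gK rmorph1.
have psiY : psi (Y s) = k (unit_coord s).
  rewrite rmorph_aff rmorphN rmorphM psiw.
  rewrite (eq_aff _ _ _ (aff v (1 + l * v) (k \o unit_coord))) => [|m lems]; last first.
    by rewrite /= psiX // (leq_ltn_trans lems).
  rewrite aff_aff (mulrC (psi gi) (1 + _)) psiK; rewrite [X in aff X](_ : _ = 0) ?aff_id //.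
  by ring.
rewrite phiZ //; case: s ltsq psiY => [|[|s]] //= ltsq psiY.
  by rewrite rmorphXn psi1 exprMn mulrC kv.
by rewrite rmorphM rmorphXn psi0 psiY -rmorphXn -rmorphM [in RHS]unit_coordE.
Qed.

End UnitMap.

(** * The coaction on the coordinates, with [c] for b -> b ⊗ 1 and [t] for 1 ⊗ T *)

Section Coaction.
Context {Q : comNzRingType} (c rho : {rmorphism S -> Q}) (t : Q) (tX : t ^+ q = 0).
Hypothesis rhoC : forall a, rho (i a) = c (i a).
Hypothesis rhoX : forall s, (s < q)%N ->
  rho (x s) = aff t (1 + c (i lam) * t) (c \o x) s.
Context (phi : {rmorphism C -> S}).
Hypothesis phiC : forall a, phi (j a) = i a.
Hypothesis phiZ : forall s, (s < q)%N -> phi (z s) = quot_coord s.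

Let rho0 : rho (x 0%N) = c (x 0%N).
Proof. by rewrite rhoX ?aff0 // ltnW ?pexpn_gt1. Qed.

Let rho1 : rho (x 1%N) = t * c (x 0%N) + (1 + c (i lam) * t) * c (x 1%N).
Proof. by rewrite rhoX ?pexpn_gt1 // aff1. Qed.

Let cx0K : c (x 0%N) * c x0i = 1.
Proof. by rewrite -rmorphM x0K rmorph1. Qed.

Let cg : c g = 1 + c (i lam) * c w.
Proof. by rewrite rmorphD rmorph1 rmorphM. Qed.

(** As X_0 is coinvariant, it is enough to divide rho(X_1) by it. *)
Lemma coaction_ratio : rho w = c w + c g * t.
Proof.
have -> : rho w = rho (x 1%N) * c x0i.
  rewrite rmorphM; congr (_ * _); apply: (inverse_unique (c (x 0%N))) => //.
  by rewrite -rho0 -rmorphM x0K rmorph1.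
rewrite rho1 mulrDl -mulrA cx0K cg /w rmorphM.
by ring.
Qed.

Let rhogi : rho gi * (1 + c (i lam) * t) = c gi.
Proof.
have cgK : c g * c gi = 1 by rewrite -rmorphM gK rmorph1.
apply: (inverse_unique (c g)) => //; rewrite mulrCA.
have -> : c g * (1 + c (i lam) * t) = rho g.
  by rewrite /g [RHS]rmorphD rmorph1 [rho (_ * w)]rmorphM rhoC coaction_ratio -/g cg; ring.
by rewrite mulrC -rmorphM gK rmorph1.
Qed.

(** By [coaction_ratio], rho(g) = g (1 + lam t). So -rho(w)/rho(g) + (t + (1 + lam t) T)/rho(g)
    simplifies to -w/g + T/g, the substitution that defines Y. *)
Lemma coaction_normal_coord s : (s < q)%N -> rho (Y s) = c (Y s).
Proof.
move=> ltsq; rewrite !rmorph_aff.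
rewrite (eq_aff _ _ _ (aff t (1 + c (i lam) * t) (c \o x))) => [|m lems]; last first.
  by rewrite /= rhoX // (leq_ltn_trans lems).
rewrite aff_aff rhogi; congr (aff _ _ _ _).
by rewrite !rmorphN (rmorphM rho w) (rmorphM c w) coaction_ratio -rhogi cg; ring.
Qed.

Lemma coaction_quot_map a : rho (phi a) = c (phi a).
Proof.
have q_gt1 := pexpn_gt1.
case: hC => _ _ /(_ Q (rho \o phi) (c \o phi)); apply=> [b|s ltsq] /=.
  by rewrite phiC rhoC.
rewrite phiZ //; case: s ltsq => [|[|s]] //= ltsq; last first.
  by rewrite !rmorphM !rmorphXn /= rho0 coaction_normal_coord.
(* Frobenius gives rho(X_1)^q = t^q X_0^q + (1 + lam^q t^q) X_1^q, and t^q = 0. The morphism [f]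
   provides the characteristic of Q. *)
have f : {rmorphism R -> Q} := c \o i; rewrite !rmorphXn /=.
rewrite rho1 (frobeniusD f) !exprMn (frobeniusD f) expr1n exprMn tX.
by rewrite mul0r mulr0 add0r addr0 mul1r.
Qed.

End Coaction.

(** * Coinvariants as constant polynomials in w *)

Lemma size_affp {B : comNzRingType} (u v : B) : (size (affp u v) <= 2)%N.
Proof.
rewrite (leq_trans (size_polyD _ _)) // geq_max (leq_trans (size_polyC_leq1 _)) //.
by rewrite (leq_trans (size_scale_leq _ _)) // size_polyX.
Qed.

Lemma map_polyC_horner {B : comNzRingType} (h P : {poly B}) (u : B) v :
  (map_poly (qpolyC h) P).[in_qpoly h (affp u v)] = in_qpoly h (P \Po affp u v).
Proof.
rewrite comp_polyE raddf_sum horner_poly; apply: eq_bigr => m _ /=.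
rewrite in_qpolyZ rmorphXn /= -[RHS]mulr_algl; congr (_ * _).
by apply: val_inj; rewrite /= -[RHS]mul_polyC mulr1.
Qed.

Lemma coinvariants_quot (rho : {rmorphism S -> {poly %/ ('X^q : {poly S})}}) :
  let t := in_qpoly ('X^q : {poly S}) 'X in
  let c : {rmorphism S -> _} := qpolyC ('X^q : {poly S}) in
  (forall a, rho (i a) = c (i a)) ->
  (forall s, (s < q)%N -> rho (x s) = aff t (1 + c (i lam) * t) (c \o x) s) ->
  exists phi : {rmorphism C -> S},
    [/\ forall a, phi (j a) = i a, injective phi, forall a, rho (phi a) = c (phi a)
      & forall b, rho b = c b -> exists a, b = phi a].
Proof.
move=> t c rhoC rhoX; have q_gt1 := pexpn_gt1; have q_gt0 := ltnW q_gt1.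
have tX : t ^+ q = 0.
  by have := in_truncX q S; rewrite prednK // => <-; rewrite /t -rmorphXn.
have [phi [phiC phiZ]] := quot_map_exists.
pose h : {poly C} := 'X^q - (z 1%N * z0i ^+ q)%:P.
(* [mk_monic] keeps only monic polynomials of positive degree and defaults to 'X, so q > 0 matters
   here. *)
have h_monic : mk_monic h = h.
  by rewrite /mk_monic /h size_XnsubC // ltnS q_gt0 monicXnsubC.
have phi0i : phi z0i = x0i.
  apply: (inverse_unique (x 0%N)) => //.
  by rewrite -[x 0%N](phiZ 0%N) // -rmorphM z0K rmorph1.
have hw : (map_poly phi (mk_monic h)).[w] = 0.
  rewrite h_monic /h rmorphB /= map_polyXn map_polyC hornerD hornerN hornerXn hornerC.
  apply/eqP; rewrite subr_eq0; apply/eqP/esym.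
  by rewrite -[LHS]/(phi (z 1%N * z0i ^+ q)) rmorphM rmorphXn /= phi0i phiZ // -exprMn.
pose v := in_qpoly h 'X; pose k := qpolyC h.
have kv : k (z 0%N) ^+ q * v ^+ q = k (z 1%N).
  have -> : v ^+ q = k (z 1%N * z0i ^+ q).
    rewrite /v -rmorphXn /= -[X in in_qpoly h X](subrK (z 1%N * z0i ^+ q)%:P) -/h.
    rewrite raddfD /= (_ : in_qpoly h h = 0) ?add0r; apply: val_inj => /=.
      by rewrite Pdiv.CommonRing.rmodp_small // size_polyC h_monic size_XnsubC //;
         case: eqP.
    by rewrite h_monic Pdiv.RingMonic.rmodpp // monicXnsubC.
  by rewrite -rmorphXn -rmorphM mulrCA -exprMn z0K expr1n mulr1.
have [psi [psiC psiX]] := unit_map_exists k v kv.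
pose theta : {rmorphism {poly %/ h} -> S} := qpoly_eval h phi w hw.
(* On generators this is [aff_normal_coord]: theta sends v to w and [unit_coord] to Y. *)
have thetaK a : theta (psi a) = a.
  case: hS => _ _ /(_ S (theta \o psi) idfun); apply=> [e|s ltsq] /=.
    by rewrite psiC [LHS]qpoly_evalC phiC.
  have thetav : theta v = w by rewrite [LHS]qpoly_eval_in map_polyX hornerX.
  have thetaC e : theta (k e) = phi e by exact: qpoly_evalC.
  rewrite psiX // rmorph_aff rmorphD rmorph1 rmorphM thetav /= thetaC phiC.
  rewrite -[RHS]aff_normal_coord; apply: eq_aff => m lems; rewrite /= thetaC.
  have ltmq := leq_ltn_trans lems ltsq.
  case: m ltmq {lems} => [|[|m]] ltmq.
  - by rewrite /= phiZ // normal_coord0.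
  - by rewrite /= rmorph0 normal_coord1.
  rewrite /= rmorphM rmorphXn phi0i phiZ //= mulrA -exprMn.
  by rewrite mulrC [x0i * _]mulrC x0K expr1n mulr1.
have psiphi := unit_quot_map k v kv psi phi psiC psiX phiC phiZ.
exists phi; split=> // [a b /(congr1 psi)|a|b rhob].
(* psi after phi is the embedding of C as the constants of C[T]/(h). *)
- by rewrite !psiphi => /(congr1 (fun P : {poly %/ h} => (P : {poly C})));
     rewrite /k !qpolyCE => /polyC_inj.
- exact: (coaction_quot_map c rho t tX rhoC rhoX phi phiC phiZ).
(* The representative of psi b has degree < q, and theta evaluates it at w to give back b. *)
pose F := map_poly phi (psi b : {poly C}).
have Fw : F.[w] = b by rewrite -[RHS]thetaK.
have sF : (size F <= q)%N.
  rewrite (leq_trans (size_poly _ _)) // -ltnS (leq_trans (size_mk_monic _)) //.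
  by rewrite h_monic size_XnsubC.
have small (P : {poly S}) : (size P <= q)%N -> in_qpoly 'X^q P = P :> {poly S}.
  by move=> sP; rewrite in_qpoly_small // mk_monic_Xn size_polyXn prednK.
(* This holds modulo T^q by coinvariance; both sides have degree < q, so it holds between
   polynomials over S. *)
have e : F \Po affp w g = b%:P.
  have sC : (size b%:P <= q)%N by rewrite size_polyC; case: eqP.
  have sA : (size (F \Po affp w g) <= q)%N.
    rewrite (leq_trans (size_comp_poly_leq _ _)) // (@leq_trans (size F).-1.+1) //.
      rewrite ltnS -[leqRHS]muln1 leq_mul //.
      by have := size_affp w g; case: (size _) => // -[].
    by case: (size F) sF.
  rewrite -[LHS]small // -[RHS]small //; congr (qpoly.polyn _).
  have cC a : in_qpoly 'X^q a%:P = c a.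
    by apply: val_inj; rewrite [LHS]small ?qpolyCE // size_polyC; case: eqP.
  (* The coefficients of F lie in the image of phi, where rho and [c] agree, so rho(F(w)) is F
     evaluated at rho(w) = w + g T. *)
  rewrite -map_polyC_horner cC -rhob -Fw -[RHS]horner_map; congr (_.[_]).
    apply/polyP => m; rewrite [LHS]coef_map [RHS]coef_map /= /F coef_map /=; apply: esym.
    exact: (coaction_quot_map c rho t tX rhoC rhoX phi phiC phiZ).
  rewrite (coaction_ratio c rho t rhoX) /affp raddfD /= in_qpolyZ -/t cC.
  by congr (_ + _); rewrite -mulr_algl; congr (_ * _); apply: val_inj; rewrite /= -mul_polyC mulr1.
have : F = b%:P.
  (* Composing with the inverse of w + g T undoes the substitution and leaves the constant b
     unchanged. *)
  rewrite -[LHS]comp_polyXr.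
  have -> : 'X = affp w g \Po affp (- (w * gi)) gi.
    rewrite affp_comp gK /affp scale1r (_ : w + _ = 0) ?polyC0 ?add0r //.
    by transitivity (w * (1 - g * gi)); [ring | rewrite gK; ring].
  by rewrite comp_polyA e comp_polyC.
(* The constant coefficient of F is phi of that of psi b, which is the preimage sought. *)
move=> /(congr1 (coefp 0)); rewrite /= coefC eqxx coef_map => <-.
by eexists.
Qed.

End Core.

(** The inverses fixed in the section above exist: X_0 and X_0 g are the factors of index 0 and 1 of
    [Delta], and Z_0 divides [quotDen]. *)
Lemma coinvariants_presented {R S C : comNzRingType} {p n : nat} (p_pr : prime p)
    (n_gt0 : (0 < n)%N) (charRp : p \in [pchar R]) (lam : R) (q := (p ^ n)%N)
    (i : {rmorphism R -> S}) (x : nat -> S) (j : {rmorphism R -> C}) (z : nat -> C)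
    (rho : {rmorphism S -> {poly %/ ('X^q : {poly S})}})
    (t := in_qpoly ('X^q : {poly S}) 'X)
    (c : {rmorphism S -> _} := qpolyC ('X^q : {poly S})) :
  presents i x (Delta q lam) -> presents j z (quotDen q lam) ->
  (forall a, rho (i a) = c (i a)) ->
  (forall s, (s < q)%N -> rho (x s) = aff t (1 + c (i lam) * t) (c \o x) s) ->
  exists phi : {rmorphism C -> S},
    [/\ forall a, phi (j a) = i a, injective phi, forall a, rho (phi a) = c (phi a)
      & forall b, rho b = c b -> exists a, b = phi a].
Proof.
move=> hS hC; have q_gt1 : (1 < q)%N := pexpn_gt1 p_pr n_gt0; have q_gt0 := ltnW q_gt1.
have [x0i x0K] : invertible (x 0%N).
  by rewrite -(aff0 1 (i lam)); exact: Delta_factor_invertible hS _ _.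
have [gi gK] : invertible (1 + i lam * (x 1%N * x0i)).
  have := Delta_factor_invertible lam i x hS _ q_gt1.
  suff -> : aff 1 (i lam) x 1 = x 0%N * (1 + i lam * (x 1%N * x0i)).
    by case/invertibleMP.
  rewrite aff1; transitivity (x 0%N + i lam * x 1%N * (x 0%N * x0i)); last by ring.
  by rewrite x0K; ring.
have [z0i z0K] : invertible (z 0%N).
  case: hC => + _ _; rewrite /quotDen !rmorphM /= ev_var //.
  by rewrite !invertibleMP => -[[]].
exact: (coinvariants_quot p_pr n_gt0 charRp lam i x hS j z hC x0i gi x0K gK z0i z0K).
Qed.

(** * The concrete coaction and the isomorphism of algebras *)

Lemma scaleX_alg {R : comNzRingType} {A : comAlgType R} (a : R) k (v : A) :
  a ^+ k *: v = a%:A ^+ k * v.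
Proof. by rewrite -(rmorphXn (in_alg A)) /= mulr_algl. Qed.

Section Coaction.
Context {R : comNzRingType} {q : nat} {lam : R}.
Local Notation S := (unitAlg q lam).

Lemma rho_in_alg (a : R) : rho (a%:A : S) = qpolyC 'X^q (a%:A : S).
Proof. by rewrite rho_scale rmorph1 -tensr1 tensZ rmorph1. Qed.

(** The formula for rho(X_{T^s}) is the expansion [aff_taylor] with u = T and v = lam. *)
Lemma rho_Xvar_aff s : (s < q)%N ->
  let t := in_qpoly ('X^q : {poly S}) 'X in
  let c : {rmorphism S -> _} := qpolyC ('X^q : {poly S}) in
  rho (Xvar q lam s) = aff t (1 + c (lam%:A) * t) (c \o Xvar q lam) s.
Proof.
move=> ltsq t c; rewrite rho_Xvar // aff_taylor; apply: eq_bigr => l _.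
rewrite tensCE rmorphXn /= tens1T mulrC; congr (_ * _ *+ _).
rewrite [LHS](rmorph_sum c); apply: eq_bigr => k _.
by rewrite (rmorphMn c) scaleX_alg (rmorphM c (lam%:A ^+ k)) (rmorphXn c).
Qed.

Context {C : comAlgType R} (phi : {rmorphism C -> S}).
Hypothesis phi_alg : forall a : R, phi a%:A = a%:A.
Hypothesis phi_coinv : forall a, phi a \in @coinv R q lam.

Definition to_coinv of (forall a : R, phi a%:A = a%:A) & (forall a, phi a \in @coinv R q lam) :=
  fun a : C => exist _ (phi a) (phi_coinv a) : coinvAlg q lam.
Local Notation f := (to_coinv phi_alg phi_coinv).

Lemma to_coinv_zmod : zmod_morphism f.
Proof. by move=> a b; apply: val_inj; rewrite raddfB /= raddfB. Qed.

Lemma to_coinv_monoid : monoid_morphism f.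
Proof.
by split=> [|a b]; apply: val_inj; rewrite ?rmorph1 ?rmorphM /= ?rmorph1 ?rmorphM.
Qed.

Lemma to_coinv_scalable : scalable f.
Proof.
move=> a b; apply: val_inj; rewrite linearZ /= -mulr_algl rmorphM phi_alg.
by rewrite mulr_algl.
Qed.

HB.instance Definition _ :=
  GRing.isZmodMorphism.Build C (coinvAlg q lam) f to_coinv_zmod.
HB.instance Definition _ :=
  GRing.isMonoidMorphism.Build C (coinvAlg q lam) f to_coinv_monoid.
HB.instance Definition _ :=
  GRing.isScalable.Build R C (coinvAlg q lam) *:%R f to_coinv_scalable.

Definition coinv_lrmorphism : {lrmorphism C -> coinvAlg q lam} := f.

End Coaction.

Theorem theorem3p7 (p n : nat) (p_pr : prime p) (n_gt0 : (0 < n)%N)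
  (R : comNzRingType) (charRp : p \in [pchar R]) (lam : R) :
  exists phi : {lrmorphism quotAlg lam (pexpn_gt0 n p_pr) -> coinvAlg (p ^ n) lam},
    bijective phi.
Proof.
have hS : presents (in_alg (unitAlg (p ^ n) lam)) (Xvar (p ^ n) lam)
    (Delta (p ^ n) lam) := away_presents _ _ _ _.
have hC := away_presents R _ _ (nonnilp_quotDen lam (pexpn_gt0 n p_pr)).
pose S := unitAlg (p ^ n) lam.
pose r : {rmorphism S -> {poly %/ ('X^(p ^ n) : {poly S})}} := @rho R (p ^ n) lam.
have [phi [phi_alg phi_inj phi_coinv phi_onto]] :=
  coinvariants_presented p_pr n_gt0 charRp lam _ _ _ _ r hS hC rho_in_alg
    (fun s h => rho_Xvar_aff s h).
have phi_in a : phi a \in @coinv R (p ^ n) lam by apply/eqP; rewrite phi_coinv tensr1.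
pose f := @coinv_lrmorphism R (p ^ n) lam (quotAlg lam (pexpn_gt0 n p_pr)) phi phi_alg phi_in.
exists f.
have f_onto b : exists a, f a = b.
  have /eqP rb : sval b \in @coinv R (p ^ n) lam := valP b.
  have [a ea] := phi_onto (sval b) (etrans rb (tensr1 _)).
  by exists a; apply: val_inj.
(* The inverse picks a preimage by choice; injectivity of phi makes it a left inverse. *)
exists (fun b => projT1 (cid (f_onto b))) => [a|b]; last exact: projT2 (cid (f_onto b)).
by case: cid => a' /= /(congr1 sval) /= /phi_inj.
Qed.
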